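(* Let $R$ be a $\Gamma$-ring, let $R_n$ be the discrete $\Gamma$-ring of $n$-simplices ($R_n(K)=R(K)_n$), and let $G_n$ be the group of invertible elements of the monoid $R_n[1]$; these form a simplicial group $G_\ast$. Let $G_\ast$ act on the simplicial set $FDL(R)_\ast$ (whose $n$-simplices are the formal difference laws in $R_n$) by conjugation $a\cdot r=a\,r\,a^{-1}$, and on the simplicial set $\Gamma(H\mathbb Z,R)_\ast$ (whose $n$-simplices are the multiplicative maps $H\mathbb Z\to R_n$) by conjugation $(a\cdot\phi)(x)=a\,\phi(x)\,a^{-1}$. Then the homotopy orbit simplicial sets $FDL(R)_{hG_\ast}$ and $\Gamma(H\mathbb Z,R)_{hG_\ast}$ are isomorphic.
   Context: Let $[n]=\{0,1,\dots,n\}$, pointed at $0$. A $\Gamma$-space is a functor $F$ from the finite pointed sets $[n]$ (with pointed maps) to pointed simplicial sets with $F[0]$ a point; for a pointed map $f$ we write $f$ also for $F(f)$; $\Sigma_n$ acts on $F[n]$ via permutations of $\{1,\dots,n\}$. We identify $[n]\wedge[m]$ with $[nm]$ via $i\wedge j\mapsto (j-1)n+i$, so for $a\in R[1]$ and $x\in R(K)$ we have $ax, xa\in R(K)$. A $\Gamma$-ring is a $\Gamma$-space $R$ with unit $1\in R[1]$ and associative unital multiplication given by natural maps $R(K)\wedge R(L)\to R(K\wedge L)$, $p\wedge q\mapsto pq$; it is discrete if all $R(K)$ are sets; $0\in R[1]$ denotes the basepoint. For $x\in R[2]$, $x^k\in R[2^k]$ is the $k$-fold product. A multiplicative map of $\Gamma$-rings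 is a natural transformation preserving units and products. Maps: $p^n_i:[n]\to[n-1]$, $p^n_i(j)=j$ ($j<i$), $p^n_i(i)=0$, $p^n_i(j)=j-1$ ($j>i$); for $1\le i<j\le n$ and $1\le k\le n-1$, $s^n_{i,j,k}:[n]\to[n-1]$ sends $0\mapsto0$, $i,j\mapsto k$, and the remaining elements order-preservingly and bijectively onto $\{1,\dots,n-1\}\setminus\{k\}$; $d^n_j:[n-1]\to[n]$ is the order-preserving injection missing $j$. $H\mathbb{Z}$ is the $\Gamma$-ring with $H\mathbb{Z}(K)$ the reduced free abelian group on $K$, pointed maps acting by summing coefficients along fibres, unit the inclusion of generators, multiplication $(\sum a_k k)(\sum b_l l)=\sum a_kb_l (k\wedge l)$. For $k\ge1$, split $\{1,\dots,2^k\}=A_+\sqcup A_-$ where $i\in A_+$ iff the binary expansion of $i-1$ has an even number of digits $1$. The special action of $\Sigma_{2^{k-1}}\times\Sigma_{2^{k-1}}$ on $F[2^k]$ is the action of the group of permutations of $\{1,\dots,2^k\}$ preserving $A_+$ and $A_-$. Let $\sigma$ be the nontrivial element of $\Sigma_2$. A formal difference law in a discrete $\Gamma$-ring $R$ is $r\in R[2]$ such that: (1) $p^2_2(r)=1$ and $s^2_{1,2,1}(r)=0$; (2) $p^2_1(r)\,r=r\,p^2_1(r)=\sigma(r)$ in $R[2]$; (3) for every $k\ge1$, $r^k$ is fixed under the special action; (4) for every $k\ge1$, all $1\le i<j\le 2^k$ with one of $i,j$ in $A_+$ and the other in $A_-$, and all $1\le l\le 2^k-1$: $s^{2^k}_{i,j,l}(r^k)=d^{2^k-1}_l\,p^{2^k-1}_i\,p^{2^k}_j(r^k)$.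 *)

(* Defs.v *)
From HB Require Import structures.
From mathcomp Require Import all_boot all_order all_algebra.
From Stdlib Require Import ClassicalEpsilon.
Set Implicit Arguments. Unset Strict Implicit. Unset Printing Implicit Defensive.
Import GRing.Theory.

(* Finite pointed sets [n] = {0,...,n} are represented by 'I_n.+1,    *)
(* pointed at ord0.  A pointed map [n] -> [m] is a function           *)
(* 'I_n.+1 -> 'I_m.+1 sending ord0 to ord0.                           *)
Definition pointed n m (f : 'I_n.+1 -> 'I_m.+1) : Prop := f ord0 = ord0.

Definition castT (F : nat -> Type) n m (E : n = m) (x : F n) : F m :=
  eq_rect n F x m E.
Arguments castT F {n m} E x.

(* f /\ g : [n] /\ [m] -> [n'] /\ [m'] under the identification
   [n] /\ [m] = [nm], i /\ j |-> (j-1) n + i. *)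
Definition smash_map n m n' m' (f : 'I_n.+1 -> 'I_n'.+1)
    (g : 'I_m.+1 -> 'I_m'.+1) : 'I_(n * m).+1 -> 'I_(n' * m').+1 :=
  fun k =>
    if val k == 0 then ord0 else
    let i := ((val k).-1 %% n).+1 in
    let j := ((val k).-1 %/ n).+1 in
    let i' := val (f (inord i)) in
    let j' := val (g (inord j)) in
    if (i' == 0) || (j' == 0) then ord0 else inord (j'.-1 * n' + i').

Record dGammaRing := DGammaRing {
  G_car :> nat -> Type;
  G_pt : forall n, G_car n;
  G_act : forall n m, ('I_n.+1 -> 'I_m.+1) -> G_car n -> G_car m;
  G_mul : forall n m, G_car n -> G_car m -> G_car (n * m);
  G_one : G_car 1;
  G_act_id : forall n (x : G_car n), G_act (fun i => i) x = x;
  G_act_comp : forall n m k (f : 'I_n.+1 -> 'I_m.+1) (g : 'I_m.+1 -> 'I_k.+1) x,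
      pointed f -> pointed g -> G_act (fun i => g (f i)) x = G_act g (G_act f x);
  G_act_ext : forall n m (f g : 'I_n.+1 -> 'I_m.+1) x,
      pointed f -> (forall i, f i = g i) -> G_act f x = G_act g x;
  G_act_pt : forall n m (f : 'I_n.+1 -> 'I_m.+1), pointed f -> G_act f (G_pt n) = G_pt m;
  G_zero : forall x : G_car 0, x = G_pt 0;
  (* multiplication factors through the smash product *)
  G_mul_ptl : forall n m (y : G_car m), G_mul (G_pt n) y = G_pt (n * m);
  G_mul_ptr : forall n m (x : G_car n), G_mul x (G_pt m) = G_pt (n * m);
  G_mul_nat : forall n m n' m' (f : 'I_n.+1 -> 'I_n'.+1) (g : 'I_m.+1 -> 'I_m'.+1) x y,
      pointed f -> pointed g ->
      G_mul (G_act f x) (G_act g y) = G_act (smash_map f g) (G_mul x y);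
  G_mul1l : forall n (x : G_car n), castT G_car (mul1n n) (G_mul G_one x) = x;
  G_mul1r : forall n (x : G_car n), castT G_car (muln1 n) (G_mul x G_one) = x;
  G_mulA : forall n m k (x : G_car n) (y : G_car m) (z : G_car k),
      castT G_car (esym (mulnA n m k)) (G_mul (G_mul x y) z) = G_mul x (G_mul y z)
}.
Arguments G_pt : clear implicits.
Arguments G_pt {d} n.
Arguments G_act {d n m} f x.
Arguments G_mul {d n m} x y.
Arguments G_one {d}.

Definition is_mult (A B : dGammaRing) (phi : forall n, A n -> B n) : Prop :=
  (forall n m (f : 'I_n.+1 -> 'I_m.+1) (x : A n), pointed f ->
     phi m (G_act f x) = G_act f (phi n x)) /\
  (forall n, phi n (G_pt n) = G_pt n) /\
  phi 1 G_one = G_one /\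
  (forall n m (x : A n) (y : A m), phi (n * m) (G_mul x y) = G_mul (phi n x) (phi m y)).

Definition simplicial (X : nat -> Type)
    (d : forall q, 'I_q.+2 -> X q.+1 -> X q)
    (s : forall q, 'I_q.+1 -> X q -> X q.+1) : Prop :=
  (forall q (i j : nat) (x : X q.+2), i < j -> j <= q.+2 ->
     d q (inord i) (d q.+1 (inord j) x) = d q (inord j.-1) (d q.+1 (inord i) x)) /\
  (forall q (i j : nat) (x : X q), i <= j -> j <= q ->
     s q.+1 (inord i) (s q (inord j) x) = s q.+1 (inord j.+1) (s q (inord i) x)) /\
  (forall q (i j : nat) (x : X q.+1), i < j -> j <= q.+1 ->
     d q.+1 (inord i) (s q.+1 (inord j) x) = s q (inord j.-1) (d q (inord i) x)) /\
  (forall q (j : nat) (x : X q), j <= q ->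
     d q (inord j) (s q (inord j) x) = x /\ d q (inord j.+1) (s q (inord j) x) = x) /\
  (forall q (i j : nat) (x : X q.+1), j.+1 < i -> i <= q.+2 ->
     d q.+1 (inord i) (s q.+1 (inord j) x) = s q (inord j) (d q (inord i.-1) x)).

(* Gamma-rings (with values in pointed simplicial sets), presented    *)
(* levelwise: R_q is the discrete Gamma-ring of q-simplices, and the  *)
(* face/degeneracy operators are multiplicative maps R_{q+1} -> R_q,  *)
(* R_q -> R_{q+1} satisfying the simplicial identities.               *)
Record sGammaRing := SGammaRing {
  lev : nat -> dGammaRing;
  sface : forall q, 'I_q.+2 -> forall n, lev q.+1 n -> lev q n;
  sdegen : forall q, 'I_q.+1 -> forall n, lev q n -> lev q.+1 n;
  sface_mult : forall q (i : 'I_q.+2), is_mult (fun n => @sface q i n);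
  sdegen_mult : forall q (i : 'I_q.+1), is_mult (fun n => @sdegen q i n);
  s_simplicial : forall n,
      @simplicial (fun q => lev q n) (fun q i => @sface q i n)
                 (fun q i => @sdegen q i n)
}.
Arguments sface {s q} i {n} x.
Arguments sdegen {s q} i {n} x.

Definition pmap N (i : nat) : 'I_N.+1 -> 'I_(N.-1).+1 :=
  fun t => if val t < i then inord (val t)
           else if val t == i then ord0 else inord (val t).-1.

Definition smap N (i j l : nat) : 'I_N.+1 -> 'I_(N.-1).+1 :=
  fun t => if val t == 0 then ord0
           else if (val t == i) || (val t == j) then inord l
           else let r := val t - (i < val t) - (j < val t) in
                inord (if r < l then r else r.+1).

Definition dmap M (j : nat) : 'I_(M.-1).+1 -> 'I_M.+1 :=
  fun t => if val t < j then inord (val t) else inord (val t).+1.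

Definition swap2 : 'I_3 -> 'I_3 :=
  fun t => inord (if val t == 1 then 2 else if val t == 2 then 1 else 0).

Arguments pmap : clear implicits.
Arguments smap : clear implicits.
Arguments dmap : clear implicits.

Definition ones (n : nat) : nat := \sum_(b < n) odd (n %/ 2 ^ b).

Definition inAplus (i : nat) : bool := ~~ odd (ones i.-1).

Section FDL.
Variable R : dGammaRing.

Fixpoint rpow (x : R 2) (k : nat) : R (2 ^ k) :=
  match k return R (2 ^ k) with
  | 0 => G_one
  | k'.+1 => castT R (esym (expnSr 2 k')) (G_mul (rpow x k') x)
  end.

Definition is_FDL (r : R 2) : Prop :=
  (G_act (pmap 2 2) r = G_one /\ G_act (smap 2 1 2 1) r = G_pt 1) /\
  (G_mul (G_act (pmap 2 1) r) r = G_act swap2 r /\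
   G_mul r (G_act (pmap 2 1) r) = G_act swap2 r) /\
  (forall k, 0 < k -> forall f : 'I_(2 ^ k).+1 -> 'I_(2 ^ k).+1,
     pointed f -> injective f ->
     (forall t, val t != 0 -> inAplus (val (f t)) = inAplus (val t)) ->
     G_act f (rpow r k) = rpow r k) /\
  (forall k, 0 < k -> forall i j l : nat,
     0 < i -> i < j -> j <= 2 ^ k -> inAplus i != inAplus j ->
     0 < l -> l <= (2 ^ k).-1 ->
     G_act (smap (2 ^ k) i j l) (rpow r k) =
     G_act (dmap (2 ^ k).-1 l)
       (G_act (pmap (2 ^ k).-1 i) (G_act (pmap (2 ^ k) j) (rpow r k)))).

Definition is_unit (a : R 1) : Prop :=
  exists b : R 1, (G_mul a b : R 1) = G_one /\ (G_mul b a : R 1) = G_one.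

Definition inv (a : R 1) : R 1 :=
  epsilon (inhabits a)
    (fun b : R 1 => (G_mul a b : R 1) = G_one /\ (G_mul b a : R 1) = G_one).

Definition mul1 (a b : R 1) : R 1 := G_mul a b.

Definition conj2 (a : R 1) (r : R 2) : R 2 := G_mul (G_mul a r) (inv a).
End FDL.

(* The Gamma-ring HZ: HZ[m] = reduced free abelian group on [m],      *)
(* represented by coefficient vectors on the generators 1..m          *)
(* (index k : 'I_m stands for the generator k+1).                     *)
Definition hz (m : nat) := {ffun 'I_m -> int}.

Definition hz0 m : hz m := [ffun _ => 0%R].

Definition hzact n m (f : 'I_n.+1 -> 'I_m.+1) (x : hz n) : hz m :=
  [ffun l : 'I_m => (\sum_(k < n | f (lift ord0 k) == lift ord0 l) x k)%R].

Definition hzmul n m (x : hz n) (y : hz m) : hz (n * m) :=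
  [ffun t : 'I_(n * m) =>
     (\sum_(i < n) \sum_(j < m | (j * n + i)%N == val t) x i * y j)%R].

Definition hzone : hz 1 := [ffun _ => 1%R].

Definition is_mult_HZ (R : dGammaRing) (phi : forall m, hz m -> R m) : Prop :=
  (forall n m (f : 'I_n.+1 -> 'I_m.+1) (x : hz n), pointed f ->
     phi m (hzact f x) = G_act f (phi n x)) /\
  (forall m, phi m (hz0 m) = G_pt m) /\
  phi 1 hzone = G_one /\
  (forall n m (x : hz n) (y : hz m), phi (n * m) (hzmul x y) = G_mul (phi n x) (phi m y)).

Definition conjphi (R : dGammaRing) (a : R 1) (phi : forall m, hz m -> R m) :
    forall m, hz m -> R m :=
  fun m x => castT R (mul1n m)
               (castT R (muln1 (1 * m)) (G_mul (G_mul a (phi m x)) (inv a))).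

(* Homotopy orbits: for a simplicial group G acting (on the left) on   *)
(* a simplicial set X, X_{hG} is the diagonal of the bar construction *)
(* B(pt, G, X), whose n-simplices are (g_1,...,g_n; x) with g_k in G_n *)
(* and x in X_n.  Simplicial sets are given here as subsets (P) of    *)
(* ambient graded types carrying face/degeneracy operators.           *)
Section HomotopyOrbits.
Variables (Gt X : nat -> Type).
Variables (dG : forall q, 'I_q.+2 -> Gt q.+1 -> Gt q)
          (sG : forall q, 'I_q.+1 -> Gt q -> Gt q.+1)
          (gmul : forall q, Gt q -> Gt q -> Gt q) (gone : forall q, Gt q)
          (dX : forall q, 'I_q.+2 -> X q.+1 -> X q)
          (sX : forall q, 'I_q.+1 -> X q -> X q.+1)
          (act : forall q, Gt q -> X q -> X q).
Variables (PG : forall q, Gt q -> Prop) (PX : forall q, X q -> Prop).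

Definition hG_car q := (seq (Gt q) * X q)%type.

Definition hG_mem q (gx : hG_car q) : Prop :=
  size gx.1 = q /\ (forall g, List.In g gx.1 -> PG g) /\ PX gx.2.

Definition hG_face q (i : 'I_q.+2) (gx : hG_car q.+1) : hG_car q :=
  let gs := map (dG i) gx.1 in
  let x := dX i gx.2 in
  if val i == 0 then (behead gs, x)
  else if val i == q.+1 then (take q gs, act (nth (gone q) gs q) x)
  else (take (val i).-1 gs ++ gmul (nth (gone q) gs (val i).-1) (nth (gone q) gs (val i))
          :: drop (val i).+1 gs, x).

Definition hG_degen q (i : 'I_q.+1) (gx : hG_car q) : hG_car q.+1 :=
  let gs := map (sG i) gx.1 in
  (take i gs ++ gone q.+1 :: drop i gs, sX i gx.2).
End HomotopyOrbits.

Definition ssets_iso (A B : nat -> Type)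
    (dA : forall q, 'I_q.+2 -> A q.+1 -> A q) (sA : forall q, 'I_q.+1 -> A q -> A q.+1)
    (PA : forall q, A q -> Prop)
    (dB : forall q, 'I_q.+2 -> B q.+1 -> B q) (sB : forall q, 'I_q.+1 -> B q -> B q.+1)
    (PB : forall q, B q -> Prop) : Prop :=
  exists (f : forall q, A q -> B q) (g : forall q, B q -> A q),
    (forall q a, PA q a -> PB q (f q a)) /\
    (forall q b, PB q b -> PA q (g q b)) /\
    (forall q a, PA q a -> g q (f q a) = a) /\
    (forall q b, PB q b -> f q (g q b) = b) /\
    (forall q (i : 'I_q.+2) a, PA q.+1 a -> f q (dA q i a) = dB q i (f q.+1 a)) /\
    (forall q (i : 'I_q.+1) a, PA q a -> f q.+1 (sA q i a) = sB q i (f q a)).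

Section Orbits.
Variable R : sGammaRing.

Definition Gq q := lev R q 1.
Definition G_face q (i : 'I_q.+2) (a : Gq q.+1) : Gq q := sface i a.
Definition G_degen q (i : 'I_q.+1) (a : Gq q) : Gq q.+1 := sdegen i a.
Definition G_mulq q (a b : Gq q) : Gq q := mul1 a b.
Definition G_oneq q : Gq q := G_one.
Definition G_mem q (a : Gq q) : Prop := is_unit a.

Definition FDLq q := lev R q 2.
Definition FDL_face q (i : 'I_q.+2) (r : FDLq q.+1) : FDLq q := sface i r.
Definition FDL_degen q (i : 'I_q.+1) (r : FDLq q) : FDLq q.+1 := sdegen i r.
Definition FDL_mem q (r : FDLq q) : Prop := is_FDL r.
Definition FDL_act q (a : Gq q) (r : FDLq q) : FDLq q := conj2 a r.

Definition HomZq q := forall m, hz m -> lev R q m.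
Definition HomZ_face q (i : 'I_q.+2) (phi : HomZq q.+1) : HomZq q :=
  fun m x => sface i (phi m x).
Definition HomZ_degen q (i : 'I_q.+1) (phi : HomZq q) : HomZq q.+1 :=
  fun m x => sdegen i (phi m x).
Definition HomZ_mem q (phi : HomZq q) : Prop := is_mult_HZ phi.
Definition HomZ_act q (a : Gq q) (phi : HomZq q) : HomZq q := conjphi a phi.

Definition FDL_hG_face := hG_face G_face G_mulq G_oneq FDL_face FDL_act.
Definition FDL_hG_degen := hG_degen G_degen G_oneq FDL_degen.
Definition FDL_hG_mem := hG_mem G_mem FDL_mem.

Definition HomZ_hG_face := hG_face G_face G_mulq G_oneq HomZ_face HomZ_act.
Definition HomZ_hG_degen := hG_degen G_degen G_oneq HomZ_degen.
Definition HomZ_hG_mem := hG_mem G_mem HomZ_mem.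
End Orbits.

(* Main.v *)
From mathcomp Require Import all_boot all_order all_algebra.
From mathcomp Require Import perm zify.
From Stdlib Require Import ClassicalEpsilon FunctionalExtensionality Eqdep_dec.
Require Import Defs.

Set Implicit Arguments.
Unset Strict Implicit.
Unset Printing Implicit Defensive.
Import GRing.Theory.

(** Let [rho = e1 - e2] in HZ[2]. Every element of HZ[m] is a pushforward
    [f_* rho^k], so a multiplicative map phi is determined by [phi rho], which is
    a formal difference law because [rho] is one. Conversely, given a formal
    difference law [r], put [phi (f_* rho^k) = f_* r^k]. This does not depend on [f]:
    axiom (4) lets [f] send to the base point any two indices of opposite sign with
    the same image; once no such pair is left, [f_* rho^k] determines the size of
    every signed fibre of [f], hence [f] up to a permutation covered by axiom (3).
    Uniqueness makes [r |-> phi] commute with the simplicial operators and with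
    conjugation, so it induces an isomorphism of homotopy orbits. *)

(** * Coordinates on smash products *)

Lemma smash_idx_proof n m (i : 'I_n) (j : 'I_m) : j * n + i < n * m.
Proof.
rewrite [n * m]mulnC; apply: (@leq_trans (j.+1 * n)); last by rewrite leq_mul2r ltn_ord orbT.
by rewrite mulSn addnC ltn_add2r.
Qed.

(** Here ['I_n] enumerates the points other than the base point, [i] standing for [lift ord0 i], so
    the identification (j-1)n+i becomes [j * n + i]. *)
Definition smash_idx n m (i : 'I_n) (j : 'I_m) : 'I_(n * m) :=
  Ordinal (smash_idx_proof i j).

Lemma smash_idx_mod n m (i : 'I_n) (j : 'I_m) : (j * n + i) %% n = i.
Proof. by rewrite modnMDl modn_small. Qed.

Lemma smash_idx_div n m (i : 'I_n) (j : 'I_m) : (j * n + i) %/ n = j.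
Proof.
have n_gt0 : 0 < n by case: n i => [[]|].
by rewrite divnMDl // divn_small // addn0.
Qed.

Lemma smash_idx_inj n m (i i' : 'I_n) (j j' : 'I_m) :
  (j * n + i == j' * n + i') = (i == i') && (j == j').
Proof.
apply/eqP/andP => [E | [/eqP -> /eqP -> //]].
split; apply/eqP/val_inj => /=.
  by rewrite -(smash_idx_mod i j) E smash_idx_mod.
by rewrite -(smash_idx_div i j) E smash_idx_div.
Qed.

Lemma smash_idx_surj n m (t : 'I_(n * m)) : exists i j, t = smash_idx i j :> 'I_(n * m).
Proof.
have nm_gt0 : 0 < n * m by apply: leq_ltn_trans (ltn_ord t).
have n_gt0 : 0 < n by case: n nm_gt0 {t}.
have i_lt : t %% n < n by rewrite ltn_mod.
have j_lt : t %/ n < m by rewrite ltn_divLR // [m * n]mulnC.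
by exists (Ordinal i_lt), (Ordinal j_lt); apply: val_inj; rewrite /= -divn_eq.
Qed.

Lemma sum_smash n m (P : pred 'I_(n * m)) (F : 'I_(n * m) -> int) :
  (\sum_(t | P t) F t = \sum_i \sum_(j | P (smash_idx i j)) F (smash_idx i j))%R.
Proof.
rewrite pair_big_dep /=.
pose h (p : 'I_n * 'I_m) := smash_idx p.1 p.2.
have h_inj : injective h.
  move=> [i j] [i' j'] /(congr1 val) /= /eqP.
  by rewrite smash_idx_inj => /andP [/eqP -> /eqP ->].
have h_bij : bijective h.
  by apply: inj_card_bij h_inj _; rewrite card_prod !card_ord.
by rewrite (reindex h) //=; apply: onW_bij.
Qed.

Definition smash_pt n m (a : 'I_n.+1) (b : 'I_m.+1) : 'I_(n * m).+1 :=
  if (val a == 0) || (val b == 0) then ord0 else inord (b.-1 * n + a).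

Lemma smash_ptS n m (i : 'I_n) (j : 'I_m) :
  smash_pt (lift ord0 i) (lift ord0 j) = lift ord0 (smash_idx i j).
Proof.
apply: val_inj; rewrite /smash_pt /= addnS inordK //.
by rewrite ltnS; apply: smash_idx_proof.
Qed.

Lemma smash_map0 n m n' m' (f : 'I_n.+1 -> 'I_n'.+1) (g : 'I_m.+1 -> 'I_m'.+1) :
  pointed (smash_map f g).
Proof. by []. Qed.

Lemma smash_mapS n m n' m' (f : 'I_n.+1 -> 'I_n'.+1) (g : 'I_m.+1 -> 'I_m'.+1) i j :
  smash_map f g (lift ord0 (smash_idx i j)) = smash_pt (f (lift ord0 i)) (g (lift ord0 j)).
Proof.
rewrite /smash_map /= smash_idx_mod smash_idx_div.
have -> : inord i.+1 = lift ord0 i :> 'I_n.+1.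
  by apply: val_inj; rewrite /= inordK ?ltnS.
have -> // : inord j.+1 = lift ord0 j :> 'I_m.+1.
by apply: val_inj; rewrite /= inordK ?ltnS.
Qed.

Lemma ord_liftP n (t : 'I_n.+1) : t = ord0 \/ exists i, t = lift ord0 i.
Proof. by case: (unliftP ord0 t) => [i ->|->]; [right; exists i | left]. Qed.

Lemma smash_ptE n m (a : 'I_n.+1) (b : 'I_m.+1) i j :
  (smash_pt a b == lift ord0 (smash_idx i j)) = (a == lift ord0 i) && (b == lift ord0 j).
Proof.
case: (ord_liftP a) => [->|[i' ->]]; first by rewrite /smash_pt.
case: (ord_liftP b) => [->|[j' ->]]; first by rewrite /smash_pt orbT andbF.
by rewrite smash_ptS !(inj_eq lift_inj) -val_eqE /= smash_idx_inj.
Qed.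

(** * The Gamma-ring HZ *)

Lemma hzmulE n m (x : hz n) (y : hz m) i j :
  hzmul x y (smash_idx i j) = (x i * y j)%R.
Proof.
rewrite ffunE pair_big_dep /= (big_pred1 (i, j)) // => -[i' j'] /=.
exact: smash_idx_inj.
Qed.

Lemma hz_castE n m (E : n = m) (x : hz n) t :
  castT hz E x t = x (cast_ord (esym E) t).
Proof. by case: _ / E t => t; rewrite /castT /= cast_ord_id. Qed.

Lemma hzact_id n (x : hz n) : hzact (fun i => i) x = x.
Proof.
by apply/ffunP => l; rewrite ffunE (big_pred1 l) // => i; rewrite (inj_eq lift_inj).
Qed.

Lemma hzact_comp n m k (f : 'I_n.+1 -> 'I_m.+1) (g : 'I_m.+1 -> 'I_k.+1) x :
  pointed f -> pointed g -> hzact (fun i => g (f i)) x = hzact g (hzact f x).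
Proof.
move=> _ g0; apply/ffunP => l; rewrite !ffunE.
rewrite [RHS](eq_bigr (fun i => \sum_(k | f (lift ord0 k) == lift ord0 i) x k)%R);
  last by move=> i _; rewrite ffunE.
rewrite [RHS](exchange_big_dep (fun i => g (f (lift ord0 i)) == lift ord0 l)) /=;
  last by move=> i j gi /eqP ->.
apply: eq_bigr => i gfi.
(* The middle sum runs only over points other than the base point; nothing is lost, because a
   generator sent to the base point by [f] stays there under the pointed map [g]. *)
case: (ord_liftP (f (lift ord0 i))) gfi => [->|[j ->]] gfi; first by rewrite g0 in gfi.
rewrite (big_pred1 j) // => j' /=; rewrite (inj_eq lift_inj) [j == j']eq_sym.
by have [->|] := eqVneq j' j; rewrite ?andbF ?gfi.
Qed.

Lemma hzact_ext n m (f g : 'I_n.+1 -> 'I_m.+1) x :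
  pointed f -> (forall i, f i = g i) -> hzact f x = hzact g x.
Proof. by move=> _ fg; apply/ffunP => l; rewrite !ffunE; apply: eq_bigl => i; rewrite fg. Qed.

Lemma hzact_pt n m (f : 'I_n.+1 -> 'I_m.+1) : pointed f -> hzact f (hz0 n) = hz0 m.
Proof. by move=> _; apply/ffunP => l; rewrite !ffunE big1 // => i; rewrite ffunE. Qed.

Lemma hz_zero (x : hz 0) : x = hz0 0.
Proof. by apply/ffunP => -[]. Qed.

Lemma hzmul_ptl n m (y : hz m) : hzmul (hz0 n) y = hz0 (n * m).
Proof.
by apply/ffunP => t; case: (smash_idx_surj t) => i [j ->]; rewrite hzmulE !ffunE mul0r.
Qed.

Lemma hzmul_ptr n m (x : hz n) : hzmul x (hz0 m) = hz0 (n * m).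
Proof.
by apply/ffunP => t; case: (smash_idx_surj t) => i [j ->]; rewrite hzmulE !ffunE mulr0.
Qed.

Lemma hzmul_nat n m n' m' (f : 'I_n.+1 -> 'I_n'.+1) (g : 'I_m.+1 -> 'I_m'.+1) x y :
  pointed f -> pointed g ->
  hzmul (hzact f x) (hzact g y) = hzact (smash_map f g) (hzmul x y).
Proof.
move=> _ _; apply/ffunP => t; case: (smash_idx_surj t) => i [j ->].
rewrite hzmulE !ffunE sum_smash mulr_suml [LHS]big_mkcond.
apply: eq_bigr => i' _ /=.
under [RHS]eq_bigl => j' do rewrite smash_mapS smash_ptE.
under [RHS]eq_bigr => j' _ do rewrite hzmulE.
by case: ifP => _ /=; rewrite ?big_pred0_eq // mulr_sumr.
Qed.

Lemma hzmul1l n (x : hz n) : castT hz (mul1n n) (hzmul hzone x) = x.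
Proof.
apply/ffunP => t; rewrite hz_castE.
have -> : cast_ord (esym (mul1n n)) t = smash_idx (ord0 : 'I_1) t.
  by apply: val_inj; rewrite /= muln1 addn0.
by rewrite hzmulE ffunE mul1r.
Qed.

Lemma hzmul1r n (x : hz n) : castT hz (muln1 n) (hzmul x hzone) = x.
Proof.
apply/ffunP => t; rewrite hz_castE.
have -> : cast_ord (esym (muln1 n)) t = smash_idx t (ord0 : 'I_1).
  by apply: val_inj.
by rewrite hzmulE ffunE mulr1.
Qed.

Lemma hzmulA n m k (x : hz n) (y : hz m) (z : hz k) :
  castT hz (esym (mulnA n m k)) (hzmul (hzmul x y) z) = hzmul x (hzmul y z).
Proof.
apply/ffunP => t; case: (smash_idx_surj t) => i [t' ->].
case: (smash_idx_surj t') => j [l ->]; rewrite hz_castE.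
set t'' := cast_ord _ _.
have -> : t'' = smash_idx (smash_idx i j) l by apply: val_inj => /=; nia.
by rewrite !hzmulE mulrA.
Qed.

Definition HZ : dGammaRing :=
  DGammaRing hzact_id hzact_comp hzact_ext hzact_pt hz_zero hzmul_ptl hzmul_ptr
    hzmul_nat hzmul1l hzmul1r hzmulA.

(** * Total spaces of Gamma-rings and powers *)

Section TotalMonoid.
Variable R : dGammaRing.

(* The dimension casts of the unit and associativity axioms disappear in the
   total space, which is an honest monoid. *)
Definition tot n (x : R n) : {n & R n} := existT _ n x.
Definition tmul (u v : {n & R n}) := tot (G_mul (projT2 u) (projT2 v)).

(** Equality of dimensions is decidable, so equal dependent pairs have equal second components. *)
Lemma tot_inj n (x y : R n) : tot x = tot y -> x = y.
Proof. by apply: inj_pair2_eq_dec => a b; apply: (decP (a =P b)). Qed.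

Lemma tot_cast n m (E : n = m) (x : R n) : tot (castT R E x) = tot x.
Proof. by case: _ / E. Qed.

Lemma tot_mul n m (x : R n) (y : R m) : tot (G_mul x y) = tmul (tot x) (tot y).
Proof. by []. Qed.

Lemma tmulA u v w : tmul (tmul u v) w = tmul u (tmul v w).
Proof.
case: u v w => [n x] [m y] [k z]; rewrite -[LHS](tot_cast (esym (mulnA n m k))).
by rewrite G_mulA.
Qed.

Lemma tmul1u u : tmul (tot G_one) u = u.
Proof. by case: u => n x; rewrite -[LHS](tot_cast (mul1n n)) G_mul1l. Qed.

Lemma tmulu1 u : tmul u (tot G_one) = u.
Proof. by case: u => n x; rewrite -[LHS](tot_cast (muln1 n)) G_mul1r. Qed.

Lemma rpowS (r : R 2) k : tot (rpow r k.+1) = tmul (tot (rpow r k)) (tot r).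
Proof. by rewrite /= tot_cast. Qed.

Lemma rpow1 (r : R 2) : rpow r 1 = r.
Proof. by apply: tot_inj; rewrite rpowS /= tmul1u. Qed.

Lemma rpowD (r : R 2) k l :
  tot (rpow r (k + l)) = tmul (tot (rpow r k)) (tot (rpow r l)).
Proof.
elim: l => [|l IHl]; first by rewrite addn0 tmulu1.
by rewrite addnS !rpowS IHl tmulA.
Qed.

(** Realises a dimension cast as the action of a pointed bijection, so that functoriality applies to
    casts. *)
Definition cast_pt n m (E : n = m) : 'I_n.+1 -> 'I_m.+1 := cast_ord (congr1 S E).

Lemma cast_pt0 n m (E : n = m) : pointed (cast_pt E).
Proof. exact: val_inj. Qed.

Lemma cast_act n m (E : n = m) (x : R n) : castT R E x = G_act (cast_pt E) x.
Proof.
case: _ / E; rewrite -[LHS]G_act_id; apply: G_act_ext => // i.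
by rewrite /cast_pt cast_ord_id.
Qed.

Lemma tot_eqP n m (x : R n) (y : R m) (E : n = m) :
  tot x = tot y -> G_act (cast_pt E) x = y.
Proof. by move=> xy; apply: tot_inj; rewrite -cast_act tot_cast. Qed.

(** The constant map factors through [0], where the base point is the only element. *)
Lemma act_const n m (x : R n) : G_act (fun=> ord0 : 'I_m.+1) x = G_pt m.
Proof.
rewrite (@G_act_comp R n 0 m (fun=> ord0) (fun=> ord0)) //.
by rewrite (G_zero (G_act _ x)) G_act_pt.
Qed.
End TotalMonoid.

(** * Multiplicative maps preserve formal difference laws *)

Lemma map_castT (A B : dGammaRing) (phi : forall n, A n -> B n) n m (E : n = m) x :
  phi m (castT A E x) = castT B E (phi n x).
Proof. by case: _ / E. Qed.

Lemma is_mult_rpow (A B : dGammaRing) (phi : forall n, A n -> B n) (x : A 2) k :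
  is_mult phi -> phi _ (rpow x k) = rpow (phi _ x) k.
Proof.
case=> _ [_ [phi1 phiM]]; elim: k => [//|k IHk] /=.
by rewrite map_castT phiM IHk.
Qed.

Lemma pmap_pointed N i : 0 < i -> pointed (pmap N i).
Proof. by move=> i_gt0; rewrite /pointed /pmap /= i_gt0; apply: val_inj; rewrite /= inordK. Qed.

Lemma dmap_pointed M j : 0 < j -> pointed (dmap M j).
Proof. by move=> j_gt0; rewrite /pointed /dmap /= j_gt0; apply: val_inj; rewrite /= inordK. Qed.

Lemma swap2_pointed : pointed swap2.
Proof. by apply: val_inj; rewrite /= inordK. Qed.

(** Every axiom is an equation between pushforwards, products, powers, the unit and base points, all
    of which [phi] preserves. *)
Lemma is_mult_FDL (A B : dGammaRing) (phi : forall n, A n -> B n) (x : A 2) :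
  is_mult phi -> is_FDL x -> is_FDL (phi 2 x).
Proof.
move=> phi_mult; have [phi_act [phi0 [phi1 phiM]]] := phi_mult.
case=> [[x1 x2] [[x3 x4] [x5 x6]]]; split; first split.
- by rewrite -phi_act ?x1 ?phi1 //; apply: pmap_pointed.
- by rewrite -phi_act ?x2 ?phi0.
have p1 : pointed (pmap 2 1) by apply: pmap_pointed.
split; first split.
- by rewrite -!phi_act -?phiM ?x3 //; apply: swap2_pointed.
- by rewrite -!phi_act -?phiM ?x4 //; apply: swap2_pointed.
split=> k k_gt0.
  by move=> f f0 fI fA; rewrite -is_mult_rpow // -phi_act // x5.
move=> i j l i_gt0 ij jk ijA l_gt0 lk.
have j_gt0 : 0 < j by apply: ltn_trans ij.
have pi := @pmap_pointed (2 ^ k).-1 _ i_gt0.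
have pj := @pmap_pointed (2 ^ k) _ j_gt0.
have pl := @dmap_pointed (2 ^ k).-1 _ l_gt0.
by rewrite -is_mult_rpow // -!phi_act ?x6.
Qed.

(** * The formal difference law of HZ *)

(** Digits from position [B] on vanish when [n < 2 ^ B]; the sum defining [ones] is the case
    [B = n], as [n < 2 ^ n]. *)
Lemma ones_expand n B : n < 2 ^ B -> ones n = \sum_(b < B) odd (n %/ 2 ^ b).
Proof.
have widen C D : n < 2 ^ C -> C <= D ->
    \sum_(b < C) odd (n %/ 2 ^ b) = \sum_(b < D) odd (n %/ 2 ^ b).
  move=> nC CD; rewrite (big_ord_widen _ (fun b => odd (n %/ 2 ^ b) : nat) CD).
  rewrite big_mkcond; apply: eq_bigr => b _; case: ltnP => // Cb.
  by rewrite divn_small // (leq_trans nC) // leq_exp2l.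
move=> nB; rewrite /ones; have [nB'|/ltnW Bn] := leqP n B.
  by rewrite (@widen n B) // ltn_expl.
by rewrite (@widen B n).
Qed.

(** The [k] low digits are those of [i] and the others those of [j]. *)
Lemma ones_shift i j k : i < 2 ^ k -> ones (j * 2 ^ k + i) = ones i + ones j.
Proof.
move=> ik; have pk : 0 < 2 ^ k by rewrite expn_gt0.
rewrite (@ones_expand _ (k + j)); last first.
  apply: (@leq_trans (j.+1 * 2 ^ k)); first by rewrite mulSn addnC ltn_add2r.
  by rewrite expnD mulnC leq_mul2l ltn_expl ?orbT.
rewrite big_split_ord /= (ones_expand ik); congr (_ + _).
  apply: eq_bigr => -[b bk] _ /=.
  rewrite -{1}(subnK (ltnW bk)) expnD mulnA divnMDl ?expn_gt0 //.
  by rewrite oddD oddM oddX subn_eq0 leqNgt bk andbF.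
apply: eq_bigr => b _ /=.
by rewrite expnD divnMA divnMDl // (divn_small ik) addn0.
Qed.

Definition rho : HZ 2 := [ffun t : 'I_2 => if t == ord0 then 1%R else (-1)%R].

(** Digit sums add when an index splits as [j * 2 ^ k + i], so their signs multiply exactly as the
    coefficients of a product do. Thus A+ and A- are the positive and negative generators of the
    power of [rho]. *)
Lemma rpow_rhoE k (t : 'I_(2 ^ k)) :
  (rpow rho k : hz (2 ^ k)) t = (if inAplus t.+1 then 1%R else (-1)%R).
Proof.
have E n : (if inAplus n.+1 then 1 else -1 : int)%R = ((-1) ^+ ones n)%R.
  by rewrite /inAplus -signr_odd /=; case: odd.
rewrite E {E}; elim: k t => [t|k IHk t].
  by rewrite /= ffunE; have -> : t = ord0 by [apply: ord1]; rewrite /ones big_ord0.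
rewrite /= [LHS]hz_castE.
case: (smash_idx_surj (cast_ord (esym (esym (expnSr 2 k))) t)) => i [j Et].
have -> : nat_of_ord t = j * 2 ^ k + i by have /(congr1 val) := Et.
rewrite Et hzmulE IHk ffunE ones_shift // exprD; congr (_ * _)%R.
by case: j {Et} => [[|[|[]]]] //= ?; rewrite /ones ?big_ord0 ?big_ord1.
Qed.

(** Opposite coefficients cancel wherever the pair is sent together. This gives both the vanishing
    in axiom (1) and axiom (4) for [rho]. *)
Lemma hzact_cancel n m (f g : 'I_n.+1 -> 'I_m.+1) (i j : 'I_n) (x : hz n) :
  i != j -> (x i + x j = 0)%R ->
  f (lift ord0 i) = f (lift ord0 j) ->
  g (lift ord0 i) = g (lift ord0 j) ->
  (forall t, t != i -> t != j -> f (lift ord0 t) = g (lift ord0 t)) ->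
  hzact f x = hzact g x.
Proof.
move=> ij xij fij gij fg; apply/ffunP => l; rewrite !ffunE big_mkcond [RHS]big_mkcond /=.
rewrite (bigD1 i) //= [RHS](bigD1 i) //= (bigD1 j) 1?eq_sym //=.
rewrite [in RHS](bigD1 j) 1?eq_sym //= !addrA fij gij.
have -> : ((if f (lift ord0 j) == lift ord0 l then x i else 0) +
    (if f (lift ord0 j) == lift ord0 l then x j else 0) = 0)%R.
  by case: ifP => _; rewrite // addr0.
have -> : ((if g (lift ord0 j) == lift ord0 l then x i else 0) +
    (if g (lift ord0 j) == lift ord0 l then x j else 0) = 0)%R.
  by case: ifP => _; rewrite // addr0.
by congr (_ + _)%R; apply: eq_bigr => t /andP [ti tj]; rewrite fg.
Qed.

Lemma pmapE N i (t : 'I_N.+1) : 0 < i <= N ->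
  val (pmap N i t) = if val t < i then val t else if val t == i then 0 else (val t).-1.
Proof.
case: t => t /= tN iN; rewrite /pmap /=.
by case: ifP => ti; [|case: ifP => ti' //]; rewrite inordK //; lia.
Qed.

Lemma dmapE M j (t : 'I_(M.-1).+1) : 0 < M ->
  val (dmap M j t) = if val t < j then val t else (val t).+1.
Proof.
case: t => t /= tM M_gt0; rewrite /dmap /=.
by case: ifP => tj; rewrite inordK //; lia.
Qed.

Section MergeMaps.
Variables N i j l : nat.
Hypotheses (i_gt0 : 0 < i) (ij : i < j) (jN : j <= N) (l_gt0 : 0 < l) (lN : l <= N.-1).

Lemma smapE (t : 'I_N.+1) :
  val (smap N i j l t) =
  if val t == 0 then 0 else if (val t == i) || (val t == j) then l else
  let r := val t - (i < val t) - (j < val t) in if r < l then r else r.+1.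
Proof.
case: t => t /= tN; rewrite /smap /=.
case: ifP => ? //; case: ifP => ?; rewrite inordK //=.
by case: (ltngtP i t) => ?; case: (ltngtP j t) => ?; case: ifP; lia.
Qed.

Lemma killE (t : 'I_N.+1) :
  val (dmap N.-1 l (pmap N.-1 i (pmap N j t))) =
  if (val t == i) || (val t == j) then 0 else
  let r := val t - (i < val t) - (j < val t) in if r < l then r else r.+1.
Proof.
have E : val (pmap N.-1 i (pmap N j t)) =
    if (val t == i) || (val t == j) then 0 else val t - (i < val t) - (j < val t).
  rewrite !pmapE; try lia; case: t => t /= tN.
  case: (ltngtP i t) => ?; case: (ltngtP j t) => ?;
    rewrite /= ?subn0 ?subn1; repeat case: ifP => ? //; lia.
by rewrite dmapE ?E; [case: (_ || _); rewrite ?l_gt0 | lia].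
Qed.

(** Hence axiom (4) only moves the pair [i], [j] from its common image [l] to the base point. *)
Lemma smap_eq_kill (t : 'I_N.+1) : val t != i -> val t != j ->
  smap N i j l t = dmap N.-1 l (pmap N.-1 i (pmap N j t)).
Proof.
move=> ti tj; apply: val_inj; rewrite smapE killE (negPf ti) (negPf tj) /=.
by case: eqP => // ->; rewrite !sub0n l_gt0.
Qed.
End MergeMaps.

Lemma rho_FDL : is_FDL rho.
Proof.
have rho0 : (rho : hz 2) ord0 = 1%R by rewrite ffunE.
have rho1 : (rho : hz 2) (lift ord0 ord0) = (-1)%R by rewrite ffunE.
have p1 : G_act (pmap 2 1) rho = [ffun=> (-1)%R] :> hz 1.
  apply/ffunP => l; rewrite (ord1 l) !ffunE big_mkcond /= !big_ord_recl big_ord0 /=.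
  by rewrite /pmap -!val_eqE /= ?inordK //= ?rho0 ?rho1 ?add0r ?addr0.
have sw : G_act swap2 rho = [ffun t : 'I_2 => if t == ord0 then (-1)%R else 1%R] :> hz 2.
  apply/ffunP => l; rewrite !ffunE big_mkcond /= !big_ord_recl big_ord0 /=.
  rewrite rho0 rho1 -!val_eqE /= !inordK //= addr0.
  by case: l => [[|[|[]]]] //= ?.
split; [split | split; [split | split]].
- apply/ffunP => l; rewrite (ord1 l) !ffunE big_mkcond /= !big_ord_recl big_ord0 /=.
  by rewrite /pmap -!val_eqE /= ?inordK //= ?rho0 ?rho1 ?add0r ?addr0.
(* The base point is written as the image of [rho] under the constant map, so that the pair 1, -1
   cancels on both sides. *)
- rewrite -(@act_const HZ 2 1 rho).
  apply: (@hzact_cancel _ _ _ _ ord0 (lift ord0 ord0)) => //.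
  + by rewrite rho0 rho1 addrN.
  + by case=> [[|[|[]]]].
- rewrite p1 sw; apply/ffunP => t.
  case: (@smash_idx_surj 1 2 t) => i [j ->]; rewrite [LHS]hzmulE.
  have -> : smash_idx i j = j :> 'I_2.
    by apply: val_inj; rewrite /= (ord1 i) /= muln1 addn0.
  by rewrite !ffunE; case: eqP.
- rewrite p1 sw; apply/ffunP => t.
  case: (@smash_idx_surj 2 1 t) => i [j ->]; rewrite [LHS]hzmulE.
  have -> : smash_idx i j = i :> 'I_2 by apply: val_inj; rewrite /= (ord1 j).
  by rewrite !ffunE; case: eqP.
(* Axiom (3): the fibre of a pointed bijection is a single generator, here of the same sign and
   hence with the same coefficient. *)
- move=> k _ f f0 f_inj fA; apply/ffunP => l.
  have [g fK gK] := injF_bij f_inj.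
  case: (ord_liftP (g (lift ord0 l))) => [gl|[t gl]].
    by have := gK (lift ord0 l); rewrite gl f0.
  have ft : f (lift ord0 t) = lift ord0 l by rewrite -gl gK.
  rewrite ffunE (big_pred1 t); last first.
    by move=> t' /=; rewrite -ft (inj_eq f_inj) (inj_eq lift_inj).
  by rewrite !rpow_rhoE; have := fA (lift ord0 t) isT; rewrite ft => ->.
move=> k _ i j l i_gt0 ij jk ijA l_gt0 lk.
have i'_lt : i.-1 < 2 ^ k by lia.
have j'_lt : j.-1 < 2 ^ k by lia.
have pi := @pmap_pointed (2 ^ k).-1 _ i_gt0.
have pj := @pmap_pointed (2 ^ k) _ (ltn_trans i_gt0 ij).
have pl := @dmap_pointed (2 ^ k).-1 _ l_gt0.
rewrite -!G_act_comp //; last by rewrite /pointed pi.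
pose i' := Ordinal i'_lt; pose j' := Ordinal j'_lt.
have Ei : val (lift ord0 i') = i by rewrite /= /bump; lia.
have Ej : val (lift ord0 j') = j by rewrite /= /bump; lia.
apply: (@hzact_cancel _ _ _ _ i' j').
- by rewrite -val_eqE /=; lia.
- rewrite !rpow_rhoE /= !prednK //; last by lia.
  by case: (inAplus i) (inAplus j) ijA => [] [].
- by apply: val_inj; rewrite !smapE // Ei Ej !eqxx orbT (gtn_eqF i_gt0) (gtn_eqF (ltn_trans i_gt0 ij)).
- by apply: val_inj; rewrite !killE // Ei Ej !eqxx orbT.
move=> t ti tj; rewrite smap_eq_kill //.
- by apply: contra ti => /eqP Et; rewrite -val_eqE /= -Et.
- by apply: contra tj => /eqP Et; rewrite -val_eqE /= -Et.
Qed.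

(** * Well-definedness *)

(** Renumbering after the removal of [i] and [j] is undone by reopening the gap at [i] first and the
    gap at [j] second. *)
Lemma merge_unskip (i j t : nat) : i < j -> t != i -> t != j ->
  let r := t - (i < t) - (j < t) in let u := if r < i then r else r.+1 in
  (if u < j then u else u.+1) = t.
Proof.
move=> ij ti tj r; have -> : (if r < i then r else r.+1) = if t < j then t else t.-1.
  rewrite /r; case: (ltngtP i t) ti => // it _; case: (ltngtP j t) tj => // jt _ /=;
    rewrite ?subn0 ?subn1; case: ifP => ?; lia.
by move=> /=; case: (ltnP t j) => ?; case: ifP => ?; lia.
Qed.

(** A map with [f i = f j] factors through the merge of [i] and [j], which axiom (4) replaces by a
    map killing both. *)
Lemma FDL_cancel_pair (A : dGammaRing) (a : A 2) k m (f : 'I_(2 ^ k).+1 -> 'I_m.+1)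
    (i j : 'I_(2 ^ k).+1) :
  is_FDL a -> pointed f -> 0 < i -> i < j -> inAplus i != inAplus j -> f i = f j ->
  G_act f (rpow a k) =
  G_act (fun t => if (t == i) || (t == j) then ord0 else f t) (rpow a k).
Proof.
move=> [_ [_ [_ a_kill]]] f0 i_gt0 ij ijA fij.
have jk : j <= 2 ^ k by rewrite -ltnS.
have pk : 1 < 2 ^ k by lia.
have k_gt0 : 0 < k by case: (posnP k) pk => // ->.
(* [h] is [f] after the injection missing [j]. Axiom (4) is applied with [l] equal to [i], so that
   the merged pair lands where [h] has the value [f i]. *)
pose h (u : 'I_((2 ^ k).-1).+1) := f (inord (if u < j then u : nat else u.+1)).
have h0 : pointed h.
  rewrite /pointed /h (ltn_trans i_gt0 ij) -[RHS]f0; congr f.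
  by apply: val_inj; rewrite /= inordK.
have ik : i <= (2 ^ k).-1 by lia.
have pi := @pmap_pointed (2 ^ k).-1 _ i_gt0.
have pj := @pmap_pointed (2 ^ k) _ (ltn_trans i_gt0 ij).
have pl := @dmap_pointed (2 ^ k).-1 _ i_gt0.
rewrite (@G_act_ext _ _ _ f (fun t => h (smap (2 ^ k) i j i t))) //; last first.
  move=> t; rewrite /h !smapE //; case: (eqVneq (val t) 0) => [t0|t_neq0].
    rewrite (ltn_trans i_gt0 ij); congr f.
    by apply: val_inj; rewrite t0 /= inordK.
  case: (eqVneq (val t) (val i)) => [ti|ti] /=.
    by rewrite ij inord_val (val_inj ti).
  case: (eqVneq (val t) (val j)) => [tj|tj] /=; first by rewrite ij inord_val (val_inj tj).
  by rewrite (merge_unskip ij ti tj) inord_val.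
rewrite G_act_comp // a_kill // -!G_act_comp //; try by rewrite /pointed ?pi pl.
apply: G_act_ext; first by rewrite /pointed pj pi pl.
move=> t; rewrite /h !killE //.
case: (boolP ((t == i) || (t == j))) => tij.
  rewrite (ltn_trans i_gt0 ij) -[RHS]f0; congr f.
  by apply: val_inj; rewrite /= inordK.
by move: tij; rewrite negb_or => /andP [ti tj]; rewrite merge_unskip // inord_val.
Qed.

(** No pair is left to cancel: fibres away from the base point have constant sign. The index 0
    carries no sign, hence [0 < i]. *)
Definition reduced N m (f : 'I_N.+1 -> 'I_m.+1) :=
  forall i j : 'I_N.+1, 0 < i -> i < j -> f i = f j -> f i != ord0 -> inAplus i = inAplus j.

(** Each cancellation lowers the number of indices not sent to the base point. The map [f'] is found
    before [A] and [a], so one reduction serves both [HZ] and the given ring. *)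
Lemma FDL_reduce k m (f : 'I_(2 ^ k).+1 -> 'I_m.+1) : pointed f ->
  exists f' : 'I_(2 ^ k).+1 -> 'I_m.+1,
    [/\ pointed f', reduced f' &
        forall (A : dGammaRing) (a : A 2), is_FDL a ->
          G_act f (rpow a k) = G_act f' (rpow a k)].
Proof.
have [n le_n] := ubnP #|[pred t | f t != ord0]|.
elim: n => // n IHn in f le_n *; move=> f0.
pose bad := [exists i : 'I_(2 ^ k).+1, exists j : 'I_(2 ^ k).+1,
  [&& 0 < i, i < j, f i == f j, f i != ord0 & inAplus i != inAplus j]].
have [|good] := boolP bad; last first.
  exists f; split=> // i j i_gt0 ij fij fi; apply/eqP/negPn/negP => ijA.
  move/existsP: good; apply; exists i; apply/existsP; exists j.
  by rewrite i_gt0 ij fij eqxx -fij fi.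
case/existsP=> i /existsP [j /and5P [i_gt0 ij /eqP fij fi ijA]].
pose g t := if (t == i) || (t == j) then ord0 else f t.
have g0 : pointed g by rewrite /pointed /g f0; case: ifP.
have [|f' [f'0 f'_red f'E]] := IHn g _ g0.
  rewrite -ltnS; apply: leq_trans le_n; rewrite ltnS; apply: proper_card.
  apply/properP; split.
    by apply/subsetP => t; rewrite !inE /g; case: ifP => //; rewrite eqxx.
  by exists i; rewrite !inE // /g eqxx.
exists f'; split=> // A a a_FDL.
by rewrite -f'E // (FDL_cancel_pair a_FDL f0 i_gt0 ij ijA fij).
Qed.

(** Equal fibre sizes make the two tuples of values rearrangements of each other. *)
Lemma eq_fibres_perm (T : eqType) N (F G : 'I_N -> T) :
  (forall x, #|[pred t | F t == x]| = #|[pred t | G t == x]|) ->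
  exists p : 'S_N, forall t, F t = G (p t).
Proof.
move=> FG.
have : perm_eq [tuple F t | t < N] [tuple G t | t < N].
  apply/allP => x _ /=; rewrite !count_map; have := FG x.
  by rewrite !cardE !size_filter => E; apply/eqP.
case/tuple_permP => p E; exists p => t.
have Et : [tuple F t | t < N] = [tuple tnth [tuple G t | t < N] (p i) | i < N] by apply: val_inj.
by have := congr1 (fun u => tnth u t) Et; rewrite !tnth_mktuple.
Qed.

Section Fibres.
Variables (k m : nat).
Local Notation N := (2 ^ k).

Definition fibre (f : 'I_N.+1 -> 'I_m.+1) (s : bool) (l : 'I_m.+1) :=
  #|[pred t : 'I_N | (inAplus t.+1 == s) && (f (lift ord0 t) == l)]|.

Lemma hzact_fibre f l :
  (hzact f (rpow rho k) : hz m) l =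
  ((fibre f true (lift ord0 l))%:Z - (fibre f false (lift ord0 l))%:Z)%R.
Proof.
rewrite ffunE (bigID (fun t : 'I_N => inAplus t.+1)) /=; congr (_ + _)%R.
  rewrite (eq_bigr (fun=> 1%R)) => [|t /andP [_ tA]]; last by rewrite rpow_rhoE tA.
  rewrite sumr_const natz /fibre; congr (_%:Z)%R.
  by apply: eq_card => t; rewrite !inE unfold_in andbC; case: inAplus.
rewrite (eq_bigr (fun=> (-1)%R)) => [|t /andP [_ /negPf tA]]; last by rewrite rpow_rhoE tA.
rewrite sumr_const mulNrn natz /fibre; congr (- _%:Z)%R.
by apply: eq_card => t; rewrite !inE unfold_in andbC; case: inAplus.
Qed.

Lemma reduced_fibre f l : reduced f -> l != ord0 ->
  fibre f true l = 0 \/ fibre f false l = 0.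
Proof.
move=> f_red l0; case: (posnP (fibre f true l)) => [->|]; first by left.
move=> /card_gt0P [i]; rewrite inE => /andP [/eqP iA /eqP fi].
right; apply: eq_card0 => j; rewrite inE; apply/negP => /andP [/eqP jA /eqP fj].
have fij : f (lift ord0 i) = f (lift ord0 j) by rewrite fi fj.
case: (ltngtP i j) => [ij|ji|/val_inj Eij].
- have := f_red (lift ord0 i) (lift ord0 j) isT ij fij.
  by rewrite fi => /(_ l0) /=; rewrite /bump /= !add1n iA jA.
- have := f_red (lift ord0 j) (lift ord0 i) isT ji (esym fij).
  by rewrite fj => /(_ l0) /=; rewrite /bump /= !add1n iA jA.
- by rewrite Eij jA in iA.
Qed.

Lemma sum_fibre f s : \sum_l fibre f s l = #|[pred t : 'I_N | inAplus t.+1 == s]|.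
Proof.
rewrite -sum1_card (partition_big (fun t => f (lift ord0 t)) predT) //=.
by apply: eq_bigr => l _; rewrite sum1_card; apply: eq_card => t; rewrite !inE.
Qed.

(** A coefficient is the difference of the positive and negative fibre sizes. For a reduced map one
    of the two is zero, so the coefficient determines both. *)
Lemma reduced_perm (f g : 'I_N.+1 -> 'I_m.+1) :
  reduced f -> reduced g ->
  hzact f (rpow rho k) = hzact g (rpow rho k) ->
  exists p : 'S_N, forall t, inAplus (p t).+1 = inAplus t.+1 /\
    f (lift ord0 t) = g (lift ord0 (p t)).
Proof.
move=> f_red g_red fg.
have fibS s l : fibre f s (lift ord0 l) = fibre g s (lift ord0 l).
  have := congr1 (fun x : hz m => x l) fg; rewrite !hzact_fibre.
  have := @reduced_fibre f (lift ord0 l) f_red isT.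
  have := @reduced_fibre g (lift ord0 l) g_red isT.
  by case: s; lia.
have fib s l : fibre f s l = fibre g s l.
  case: (ord_liftP l) => [->|[l' ->]] //; apply/eqP.
  (* Coefficients do not see the fibre over the base point; its size is what remains of the total
     number of indices of sign [s]. *)
  have /eqP := etrans (sum_fibre f s) (esym (sum_fibre g s)).
  by rewrite !big_ord_recl (eq_bigr _ (fun l _ => fibS s l)) eqn_add2r.
have [|p pE] := @eq_fibres_perm _ N (fun t => (inAplus t.+1, f (lift ord0 t)))
                  (fun t => (inAplus t.+1, g (lift ord0 t))).
  by case=> s l; have := fib s l.
by exists p => t; have [-> ->] := pE t.
Qed.
End Fibres.

Lemma FDL_well_defined (A : dGammaRing) (a : A 2) k m (f g : 'I_(2 ^ k).+1 -> 'I_m.+1) :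
  is_FDL a -> 0 < k -> pointed f -> pointed g ->
  hzact f (rpow rho k) = hzact g (rpow rho k) ->
  G_act f (rpow a k) = G_act g (rpow a k).
Proof.
move=> a_FDL k_gt0 f0 g0.
have [f' [f'0 f'_red f'E]] := FDL_reduce f0.
have [g' [g'0 g'_red g'E]] := FDL_reduce g0.
have fE : hzact f (rpow rho k) = hzact f' (rpow rho k) := f'E HZ _ rho_FDL.
have gE : hzact g (rpow rho k) = hzact g' (rpow rho k) := g'E HZ _ rho_FDL.
rewrite f'E // g'E // fE gE => /(reduced_perm f'_red g'_red) [p pE].
pose q := lift_perm ord0 ord0 p.
have q0 : pointed q by rewrite /pointed lift_perm_id.
have [_ [_ [a_perm _]]] := a_FDL.
(* Axiom (3) inserts [q] on the right, after which the two maps agree pointwise. *)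
rewrite -[in RHS](a_perm k k_gt0 q q0 perm_inj); last first.
  move=> t; case: (ord_liftP t) => [->|[t' ->]] // _.
  by rewrite lift_perm_lift /=; case: (pE t').
rewrite -G_act_comp //; apply: G_act_ext => // t.
case: (ord_liftP t) => [->|[t' ->]]; first by rewrite q0 f'0 g'0.
by rewrite lift_perm_lift; case: (pE t').
Qed.

(** * Comparison of different exponents *)

Definition pad_map k (t : 'I_(2 ^ k.+1).+1) : 'I_(2 ^ k).+1 :=
  cast_pt (muln1 (2 ^ k)) (smash_map (fun i => i) (pmap 2 2) (cast_pt (expnSr 2 k) t)).

Lemma pad_map0 k : pointed (@pad_map k).
Proof. by rewrite /pointed /pad_map cast_pt0 smash_map0 cast_pt0. Qed.

(** By axiom (1), [pmap 2 2] turns the last factor of the power into the unit. *)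
Lemma pad_rpow (A : dGammaRing) (a : A 2) k :
  is_FDL a -> G_act (@pad_map k) (rpow a k.+1) = rpow a k.
Proof.
move=> [[a1 _] _].
have p22 : pointed (pmap 2 2) by apply: pmap_pointed.
have c1 := @cast_pt0 _ _ (expnSr 2 k); have c2 := @cast_pt0 _ _ (muln1 (2 ^ k)).
transitivity (G_act (cast_pt (muln1 (2 ^ k))) (G_act (smash_map id (pmap 2 2))
    (G_act (cast_pt (expnSr 2 k)) (rpow a k.+1)))).
  by rewrite -(G_act_comp _ c1) // -G_act_comp.
have -> : G_act (cast_pt (expnSr 2 k)) (rpow a k.+1) = G_mul (rpow a k) a.
  by apply: tot_eqP; rewrite rpowS.
by rewrite -G_mul_nat // G_act_id a1; apply: tot_eqP; rewrite tot_mul tmulu1.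
Qed.

(** Precomposition with padding maps. Again [f'] does not depend on the ring, so the same lift works
    in [HZ]. *)
Lemma FDL_raise k K m (f : 'I_(2 ^ k).+1 -> 'I_m.+1) : k <= K -> pointed f ->
  exists f' : 'I_(2 ^ K).+1 -> 'I_m.+1, pointed f' /\
    forall (A : dGammaRing) (a : A 2), is_FDL a ->
      G_act f' (rpow a K) = G_act f (rpow a k).
Proof.
move=> /subnKC <- f0; elim: (K - k) => [|d [f' [f'0 f'E]]]; first by rewrite addn0; exists f.
rewrite addnS; exists (fun t => f' (pad_map t)); split; first by rewrite /pointed pad_map0.
by move=> A a a_FDL; rewrite G_act_comp ?pad_rpow ?f'E //; apply: pad_map0.
Qed.

Lemma FDL_unique_value (A : dGammaRing) (a : A 2) k l m
    (f : 'I_(2 ^ k).+1 -> 'I_m.+1) (g : 'I_(2 ^ l).+1 -> 'I_m.+1) :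
  is_FDL a -> pointed f -> pointed g ->
  hzact f (rpow rho k) = hzact g (rpow rho l) ->
  G_act f (rpow a k) = G_act g (rpow a l).
Proof.
(* The successor makes the common exponent positive, as [FDL_well_defined] demands. *)
move=> a_FDL f0 g0 fg; pose K := (maxn k l).+1.
have [f' [f'0 f'E]] := @FDL_raise k K _ _ (leqW (leq_maxl k l)) f0.
have [g' [g'0 g'E]] := @FDL_raise l K _ _ (leqW (leq_maxr k l)) g0.
rewrite -f'E // -g'E //; apply: FDL_well_defined => //.
by rewrite [LHS](f'E HZ _ rho_FDL) [RHS](g'E HZ _ rho_FDL).
Qed.

(** * Representing elements of HZ by powers of rho *)

Definition representable m (x : hz m) :=
  exists k (f : 'I_(2 ^ k).+1 -> 'I_m.+1), pointed f /\ hzact f (rpow rho k) = x.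

(** For pointed [f] and [g] this is their wedge on [n] /\ [2], seen as two copies of [n]; since
    [rho] weights the copies by 1 and -1, it realises subtraction. *)
Definition glue n m (f g : 'I_n.+1 -> 'I_m.+1) (t : 'I_(n * 2).+1) : 'I_m.+1 :=
  if val t == 0 then ord0
  else (if t.-1 %/ n == 0 then f else g) (inord (t.-1 %% n).+1).

Lemma glueS n m (f g : 'I_n.+1 -> 'I_m.+1) i (j : 'I_2) :
  glue f g (lift ord0 (smash_idx i j)) = (if j == ord0 then f else g) (lift ord0 i).
Proof.
rewrite /glue /= smash_idx_mod smash_idx_div -val_eqE /=.
by congr ((if _ then _ else _) _); apply: val_inj; rewrite /= inordK ?ltnS.
Qed.

Lemma hzact_glue n m (f g : 'I_n.+1 -> 'I_m.+1) (x : hz n) :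
  hzact (glue f g) (hzmul x rho) = (hzact f x - hzact g x)%R.
Proof.
apply/ffunP => l; rewrite !ffunE sum_smash.
rewrite -sumrN [X in (X + _)%R]big_mkcond [X in (_ + X)%R]big_mkcond -big_split /=.
apply: eq_bigr => i _; rewrite big_mkcond !big_ord_recl big_ord0 /= !glueS /=.
by rewrite !hzmulE !ffunE /= mulr1 mulrN1 addr0.
Qed.

(** After raising to a common exponent [K], glueing the two maps represents the difference with
    exponent [K.+1]. *)
Lemma representableB m (x y : hz m) :
  representable x -> representable y -> representable (x - y)%R.
Proof.
move=> [k [f [f0 <-]]] [l [g [g0 <-]]]; pose K := maxn k l.
have [f' [f'0 f'E]] := @FDL_raise k K _ _ (leq_maxl k l) f0.
have [g' [g'0 g'E]] := @FDL_raise l K _ _ (leq_maxr k l) g0.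
have fE : hzact f' (rpow rho K) = hzact f (rpow rho k) := f'E HZ _ rho_FDL.
have gE : hzact g' (rpow rho K) = hzact g (rpow rho l) := g'E HZ _ rho_FDL.
have c1 := @cast_pt0 _ _ (expnSr 2 K).
exists K.+1, (fun t => glue f' g' (cast_pt (expnSr 2 K) t)); split.
  by rewrite /pointed c1.
rewrite hzact_comp // -fE -gE -hzact_glue; congr hzact.
by apply: (@tot_eqP HZ); rewrite rpowS.
Qed.

Lemma representable0 m : representable (0 : hz m)%R.
Proof. by exists 0, (fun=> ord0); split; rewrite // [LHS](@act_const HZ); apply/ffunP. Qed.

Lemma representableN m (x : hz m) : representable x -> representable (- x)%R.
Proof. by move=> xr; rewrite -sub0r; apply: representableB => //; apply: representable0. Qed.

Lemma representableD m (x y : hz m) :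
  representable x -> representable y -> representable (x + y)%R.
Proof.
by move=> xr yr; rewrite -[y]opprK; apply: representableB => //; apply: representableN.
Qed.

Lemma representable_gen m (l : 'I_m) :
  representable ([ffun t => if t == l then 1%R else 0%R] : hz m).
Proof.
(* The zeroth power of [rho] is the generator of HZ[1], which is pushed to [l]. *)
exists 0, (fun t => if val t == 0 then ord0 else lift ord0 l); split=> //.
apply/ffunP => t; rewrite !ffunE big_mkcond big_ord_recl big_ord0 /= addr0.
by rewrite (inj_eq lift_inj) eq_sym ffunE.
Qed.

(** The representable elements contain the generators and are closed under subtraction. *)
Lemma hz_representable m (x : hz m) : representable x.
Proof.
have -> : x = (\sum_l [ffun t : 'I_m => if t == l then 1%R else 0%R] *~ x l)%R.
  apply/ffunP => t; rewrite sum_ffunE (bigD1 t) //= big1 => [|l lt].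
    by rewrite addr0 ffunMzE ffunE eqxx intz.
  by rewrite ffunMzE ffunE eq_sym (negPf lt) mul0rz.
apply: (big_ind (@representable m)); [exact: representable0 | exact: representableD |].
move=> l _; have el := representable_gen l; set e := finfun _ in el *.
have en n : representable (e *+ n)%R.
  elim: n => [|n IHn]; first by rewrite mulr0n; apply: representable0.
  by rewrite mulrS; apply: representableD.
by case: (x l) => n; [exact: en | rewrite NegzE mulrNz; apply: representableN; exact: en].
Qed.

(** * The multiplicative map of a formal difference law *)

Section PhiOf.
Variable R : dGammaRing.

(** [epsilon] picks a value from some representation of [x]; [FDL_unique_value] makes the choice
    immaterial. *)
Definition phi_of (r : R 2) : forall m, hz m -> R m := fun m x =>
  epsilon (inhabits (G_pt m)) (fun y => exists k (f : 'I_(2 ^ k).+1 -> 'I_m.+1),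
    [/\ pointed f, hzact f (rpow rho k) = x & y = G_act f (rpow r k)]).

Lemma phi_ofE (r : R 2) k m (f : 'I_(2 ^ k).+1 -> 'I_m.+1) :
  is_FDL r -> pointed f -> phi_of r (hzact f (rpow rho k)) = G_act f (rpow r k).
Proof.
move=> r_FDL f0; rewrite /phi_of; set P := (fun y => _).
have : P (epsilon (inhabits (G_pt m)) P).
  by apply: epsilon_spec; exists (G_act f (rpow r k)), k, f.
by case=> l [g [g0 gf ->]]; apply: FDL_unique_value.
Qed.

Lemma phi_of_rho (r : R 2) : is_FDL r -> phi_of r rho = r.
Proof.
move=> r_FDL; have := @phi_ofE r 1 2 id r_FDL (erefl _).
by rewrite hzact_id G_act_id !rpow1.
Qed.

Lemma phi_of_mult (r : R 2) : is_FDL r -> is_mult_HZ (phi_of r).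
Proof.
move=> r_FDL; split; last split; last split.
- move=> n m g x g0; have [k [f [f0 <-]]] := hz_representable x.
  have gf0 : pointed (fun t => g (f t)) by rewrite /pointed f0.
  by rewrite (phi_ofE r_FDL f0) -hzact_comp // (phi_ofE r_FDL gf0) G_act_comp.
- move=> m; have := @phi_ofE r 0 m (fun=> ord0) r_FDL (erefl _).
  by rewrite act_const [hzact _ _](@act_const HZ).
- have := @phi_ofE r 0 1 id r_FDL (erefl _).
  by rewrite hzact_id G_act_id.
- move=> n m x y; have [k [f [f0 <-]]] := hz_representable x.
  have [l [g [g0 <-]]] := hz_representable y.
  have c1 := @cast_pt0 _ _ (expnD 2 k l).
  (* Stated for every ring because it is used twice: for [r] in [R] and for [rho] in [HZ]. *)
  have E (A : dGammaRing) (a : A 2) :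
      G_mul (G_act f (rpow a k)) (G_act g (rpow a l)) =
      G_act (fun t => smash_map f g (cast_pt (expnD 2 k l) t)) (rpow a (k + l)).
    rewrite G_mul_nat // G_act_comp //; congr (G_act _ _).
    by apply/esym/tot_eqP; rewrite rpowD.
  have fg0 : pointed (fun t => smash_map f g (cast_pt (expnD 2 k l) t)).
    by rewrite /pointed c1.
  rewrite (phi_ofE r_FDL f0) (phi_ofE r_FDL g0) E -(phi_ofE r_FDL fg0).
  by congr phi_of; apply: (E HZ).
Qed.

Lemma is_mult_HZ_FDL (phi : forall m, hz m -> R m) :
  is_mult_HZ phi -> is_FDL (phi 2 rho).
Proof. by move=> phi_mult; apply: (@is_mult_FDL HZ) => //; apply: rho_FDL. Qed.

Lemma phi_of_unique (phi : forall m, hz m -> R m) :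
  is_mult_HZ phi -> phi_of (phi 2 rho) = phi.
Proof.
move=> phi_mult; apply: functional_extensionality_dep => m.
apply: functional_extensionality => x; have [k [f [f0 <-]]] := hz_representable x.
rewrite phi_ofE //; last exact: is_mult_HZ_FDL.
have [phi_act _] := phi_mult; rewrite phi_act //; congr (G_act _ _).
by apply/esym/(@is_mult_rpow HZ).
Qed.
End PhiOf.

Lemma is_mult_comp (A B C : dGammaRing) (phi : forall n, A n -> B n)
    (psi : forall n, B n -> C n) :
  is_mult phi -> is_mult psi -> is_mult (fun n x => psi n (phi n x)).
Proof.
move=> [f1 [f2 [f3 f4]]] [g1 [g2 [g3 g4]]]; split; last split; last split.
- by move=> n m f x f0; rewrite f1 ?g1.
- by move=> n; rewrite f2 g2.
- by rewrite f3 g3.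
- by move=> n m x y; rewrite f4 g4.
Qed.

(** * Conjugation *)

Lemma cast_Gpt (R : dGammaRing) n m (E : n = m) : castT R E (G_pt n) = G_pt m.
Proof. by case: _ / E. Qed.

Section Conjugation.
Variables (R : dGammaRing) (a b : R 1).
Hypotheses (ab : (G_mul a b : R 1) = G_one) (ba : (G_mul b a : R 1) = G_one).

Definition conjg m (x : R m) : R m :=
  castT R (mul1n m) (castT R (muln1 (1 * m)) (G_mul (G_mul a x) b)).

Lemma tot_conjg m (x : R m) : tot (conjg x) = tmul (tmul (tot a) (tot x)) (tot b).
Proof. by rewrite /conjg !tot_cast. Qed.

Lemma tmul_ab : tmul (tot a) (tot b) = tot G_one.
Proof. exact: (congr1 (@tot R 1) ab). Qed.

Lemma tmul_ba : tmul (tot b) (tot a) = tot G_one.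
Proof. exact: (congr1 (@tot R 1) ba). Qed.

Lemma smash_pt1l m (i : 'I_1) (c : 'I_m.+1) : val (smash_pt (lift ord0 i) c) = c.
Proof.
case: (ord_liftP c) => [->|[j ->]] //.
by rewrite smash_ptS /= (ord1 i) /= muln1 addn0.
Qed.

Lemma smash_pt1r m (i : 'I_1) (c : 'I_m.+1) : val (smash_pt c (lift ord0 i)) = c.
Proof.
case: (ord_liftP c) => [->|[j ->]] //.
by rewrite smash_ptS /= (ord1 i).
Qed.

(** With [a] and [b] written as pushforwards along identities, naturality of the product yields id
    /\ f /\ id, which is [f] once [1n1] is identified with [n]. *)
Lemma conjg_act n m (f : 'I_n.+1 -> 'I_m.+1) (x : R n) :
  pointed f -> conjg (G_act f x) = G_act f (conjg x).
Proof.
move=> f0; rewrite /conjg !cast_act -{1}(G_act_id a) -{1}(G_act_id b) !G_mul_nat //.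
have c0 := cast_pt0.
rewrite -!G_act_comp //; try by rewrite /pointed ?c0.
apply: G_act_ext => [|t]; first by rewrite /pointed smash_map0 !c0.
case: (ord_liftP t) => [->|[t' ->]]; first by rewrite smash_map0 !c0 f0.
case: (smash_idx_surj t') => u [l ->]; case: (smash_idx_surj u) => i [j ->].
rewrite !smash_mapS; apply: val_inj.
have -> : cast_pt (mul1n n) (cast_pt (muln1 (1 * n)) (lift ord0 (smash_idx (smash_idx i j) l)))
    = lift ord0 j.
  by apply: val_inj; rewrite /= (ord1 i) (ord1 l) /= /bump /=; lia.
by rewrite /= [LHS]smash_pt1r [LHS]smash_pt1l.
Qed.

Lemma conjg_mult : @is_mult R R conjg.
Proof.
split; last split; last split.
- exact: conjg_act.
- move=> n; apply: tot_inj; rewrite /conjg G_mul_ptr G_mul_ptl.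
  by rewrite !cast_Gpt.
- by apply: tot_inj; rewrite tot_conjg tmulu1 tmul_ab.
- move=> n m x y; apply: tot_inj; rewrite tot_mul !tot_conjg tot_mul.
  by rewrite !tmulA -[in RHS](tmulA (tot b)) tmul_ba tmul1u.
Qed.
End Conjugation.

Lemma invP (R : dGammaRing) (a : R 1) : is_unit a ->
  (G_mul a (inv a) : R 1) = G_one /\ (G_mul (inv a) a : R 1) = G_one.
Proof. exact: epsilon_spec. Qed.

Lemma conjphi_mult (R : dGammaRing) (a : R 1) (phi : forall m, hz m -> R m) :
  is_unit a -> is_mult_HZ phi -> is_mult_HZ (conjphi a phi).
Proof.
move=> /invP [ab ba] phi_mult.
exact: (@is_mult_comp HZ R R phi (conjg a (inv a)) phi_mult (conjg_mult ab ba)).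
Qed.

Lemma conjphi_rho (R : dGammaRing) (a : R 1) (phi : forall m, hz m -> R m) :
  conjphi a phi rho = conj2 a (phi 2 rho).
Proof. by apply: tot_inj; rewrite [LHS]tot_conjg. Qed.

(** Both sides are multiplicative maps out of HZ with the same value at [rho]. *)
Lemma phi_of_conj (R : dGammaRing) (a : R 1) (r : R 2) :
  is_unit a -> is_FDL r -> phi_of (conj2 a r) = conjphi a (phi_of r).
Proof.
move=> a_unit r_FDL.
rewrite -(phi_of_unique (conjphi_mult a_unit (phi_of_mult r_FDL))).
by rewrite conjphi_rho phi_of_rho.
Qed.

Lemma phi_of_nat (A B : dGammaRing) (psi : forall n, A n -> B n) (r : A 2) :
  is_mult psi -> is_FDL r -> phi_of (psi 2 r) = fun m x => psi m (phi_of r x).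
Proof.
move=> psi_mult r_FDL.
have comp_mult := @is_mult_comp HZ A B _ _ (phi_of_mult r_FDL) psi_mult.
by rewrite -[RHS](phi_of_unique comp_mult) phi_of_rho.
Qed.

Lemma is_mult_unit (A B : dGammaRing) (psi : forall n, A n -> B n) (a : A 1) :
  is_mult psi -> is_unit a -> is_unit (psi 1 a).
Proof.
move=> [_ [_ [psi1 psiM]]] [b [ab ba]]; exists (psi 1 b).
by split; rewrite -psi1; [rewrite -ab | rewrite -ba]; rewrite -psiM.
Qed.

Lemma In_nth (T : Type) (x0 : T) (s : seq T) n : n < size s -> List.In (nth x0 s n) s.
Proof. by elim: s n => //= x s IHs [|n] n_lt; [left | right; apply: IHs]. Qed.

Theorem theorem3p9 (R : sGammaRing) :
  ssets_iso (@FDL_hG_face R) (@FDL_hG_degen R) (@FDL_hG_mem R)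
            (@HomZ_hG_face R) (@HomZ_hG_degen R) (@HomZ_hG_mem R).
Proof.
(* The group coordinates are kept; the last coordinate is exchanged by [phi_of] and evaluation at
   [rho]. *)
exists (fun q gx => (gx.1, phi_of gx.2)), (fun q gx => (gx.1, gx.2 2 rho)).
split; last split; last split; last split; last split.
- by move=> q [gs r] [gs_size [gsG r_FDL]]; do 2?split=> //; apply: phi_of_mult.
- by move=> q [gs phi] [gs_size [gsG phi_mult]]; do 2?split=> //; apply: is_mult_HZ_FDL.
- by move=> q [gs r] [_ [_ r_FDL]] /=; rewrite phi_of_rho.
- by move=> q [gs phi] [_ [_ phi_mult]] /=; rewrite phi_of_unique.
- move=> q i [gs r] [gs_size [gsG r_FDL]].
  have face_mult := @sface_mult R q i.
  have phi_face := phi_of_nat face_mult r_FDL.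
  rewrite /FDL_hG_face /HomZ_hG_face /hG_face /=; case: ifP => [_ | _] /=.
    by rewrite [phi_of _]phi_face.
  case: ifP => [_ | _] /=; last by rewrite [phi_of _]phi_face.
  (* Only the last face involves the action, so it alone needs compatibility with conjugation, by
     the face of the last group coordinate. *)
  rewrite /FDL_act phi_of_conj.
  + by rewrite [phi_of _]phi_face.
  (* Position [q] lies inside the list, so the default of [nth] is not reached and the entry is a
     unit, which faces preserve. *)
  + have q_lt : q < size gs by rewrite gs_size.
    rewrite (nth_map (@G_oneq R q.+1)) //; apply: is_mult_unit => //; apply: gsG.
    exact: In_nth.
  + exact: is_mult_FDL.
- move=> q i [gs r] [gs_size [gsG r_FDL]].
  have phi_degen := phi_of_nat (@sdegen_mult R q i) r_FDL.
  by rewrite /FDL_hG_degen /HomZ_hG_degen /hG_degen /= [phi_of _]phi_degen.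
Qed.
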